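(* The category $\mathbf{KBSob}$ of all $k$-bounded sober spaces and continuous mappings is a full reflective subcategory of the category $\mathbf{QKBSob}$ of all $qk$-bounded sober spaces and continuous mappings preserving existing irreducible suprema.
   Context: For a $T_0$ space $X$ the specialization order is the partial order $x\le y$ iff $x\in \mathrm{cl}(\{y\})$; all suprema $\bigvee$ in $X$ are taken with respect to this order. A non-empty subset $F$ of a topological space $X$ is irreducible if whenever $F\subseteq A\cup B$ with $A,B$ closed in $X$, then $F\subseteq A$ or $F\subseteq B$. A $T_0$ space $X$ is $k$-bounded sober if for every irreducible closed subset $F$ of $X$ whose supremum $\bigvee F$ exists, there is a unique point $x\in X$ with $F=\mathrm{cl}(\{x\})$. A mapping $f:X\to Y$ between $T_0$ spaces preserves existing irreducible suprema if for each irreducible subset $F$ of $X$ for which $\bigvee F$ exists, $f(\bigvee F)=\bigvee f(F)$ (in particular the right-hand supremum exists). For a $T_0$ space $X$, $KB(X)$ denotes the set of all irreducible closed subsets of $X$ whose suprema exist, with the topology whose closed sets are exactly the sets $K_F=\{A\in KB(X)\mid A\subseteq F\}$, $F$ a closed subset of $X$. Define the equivalence relation $\sim$ on $KB(X)$ by $F\sim G$ iff $\bigvee F=\bigvee G$, and give the set of equivalence classes $KB(X)/\!\sim$ the quotient topology. A $T_0$ space $X$ is $qk$-bounded sober if the quotient space $KB(X)/\!\sim$ is a $k$-bounded sober space. A subcategory $\mathbf A$ of a category $\mathbf B$ is reflective if for every object $B$ of $\mathbf B$ there are an object $\overline B$ of $\mathbf A$ and a $\mathbf B$-morphism $r:B\to\overline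 B$ such that for every $\mathbf B$-morphism $f:B\to A$ with $A$ an object of $\mathbf A$ there is a unique $\mathbf A$-morphism $\bar f:\overline B\to A$ with $\bar f\circ r=f$. *)

(* Defs.v *)
From HB Require Import structures.
From mathcomp Require Import all_boot all_order all_algebra all_classical.
From mathcomp Require Import topology_structure quotient_topology.
From mathcomp Require Import separation_axioms.

Set Implicit Arguments.
Unset Strict Implicit.
Unset Printing Implicit Defensive.

Local Open Scope classical_set_scope.

Record category := Category {
  obj :> Type;
  hom : obj -> obj -> Type;
  idm : forall x, hom x x;
  compm : forall x y z, hom y z -> hom x y -> hom x z;
  compm1 : forall x y (f : hom x y), compm f (idm x) = f;
  comp1m : forall x y (f : hom x y), compm (idm y) f = f;
  compmA : forall x y z t (h : hom z t) (g : hom y z) (f : hom x y),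
    compm h (compm g f) = compm (compm h g) f
}.
Arguments idm {c} x.
Arguments compm {c x y z} g f.

(* [sub_hom f] is only relevant when the source and target of [f] satisfy
   [sub_obj]. *)
Record subcat (C : category) := Subcat {
  sub_obj : C -> Prop;
  sub_hom : forall x y : C, hom x y -> Prop;
  sub_id : forall x : C, sub_obj x -> sub_hom (idm x);
  sub_comp : forall (x y z : C) (g : hom y z) (f : hom x y),
    sub_obj x -> sub_obj y -> sub_obj z ->
    sub_hom g -> sub_hom f -> sub_hom (compm g f)
}.
Arguments sub_obj {C} _ _.
Arguments sub_hom {C} _ {x y} _.

Section Subcategories.
Context {C : category}.
Implicit Types A B : subcat C.

(* [A] and [B] live in a common category [C]; that [A] is a subcategory of [B]
   is a property to be proved. *)
Definition subcategory_of A B :=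
  (forall x, sub_obj A x -> sub_obj B x) /\
  (forall x y (f : hom x y), sub_obj A x -> sub_obj A y ->
     sub_hom A f -> sub_hom B f).

Definition full_in A B :=
  forall x y (f : hom x y), sub_obj A x -> sub_obj A y ->
    sub_hom B f -> sub_hom A f.

Definition reflective_in A B :=
  forall b, sub_obj B b ->
    exists (b' : C) (r : hom b b'), sub_obj A b' /\ sub_hom B r /\
      forall (a : C) (f : hom b a), sub_obj A a -> sub_hom B f ->
        exists! g : hom b' a, sub_hom A g /\ compm g r = f.

Definition full_reflective_subcategory A B :=
  [/\ subcategory_of A B, full_in A B & reflective_in A B].

End Subcategories.

Program Definition Top : category := {|
  obj := topologicalType;
  hom := fun X Y => continuousType X Y;
  idm := fun X => idfun : continuousType X X;
  compm := fun X Y Z g f => (g \o f : continuousType X Z)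
|}.
Next Obligation. by move=> *; apply/continuousEP => x. Qed.
Next Obligation. by move=> *; apply/continuousEP => x. Qed.
Next Obligation. by move=> *; apply/continuousEP => x. Qed.

Section Specialization.
Context {X : topologicalType}.

Definition spec_le (x y : X) := closure [set y] x.

Definition is_sup (F : set X) (s : X) :=
  (forall x, F x -> spec_le x s) /\
  (forall y, (forall x, F x -> spec_le x y) -> spec_le s y).

Definition irreducible_set (F : set X) :=
  F !=set0 /\ forall A B : set X, closed A -> closed B ->
    F `<=` A `|` B -> F `<=` A \/ F `<=` B.

End Specialization.

Definition kbounded_sober (X : topologicalType) :=
  kolmogorov_space X /\
  forall F : set X, irreducible_set F -> closed F -> (exists s, is_sup F s) ->
    exists! x, F = closure [set x].

Definition preserves_irreducible_sups (X Y : topologicalType) (f : X -> Y) :=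
  forall F : set X, irreducible_set F ->
    forall s, is_sup F s -> is_sup (f @` F) (f s).

Lemma irreducible_image (X Y : topologicalType) (f : X -> Y) (F : set X) :
  continuous f -> irreducible_set F -> irreducible_set (f @` F).
Proof.
move=> cf [[x Fx] irr]; split; first by exists (f x), x.
move=> A B cA cB /image_subP FAB.
have cpre D : closed D -> closed (f @^-1` D).
  by move=> cD; apply: preimage_closed => // x _; exact: cf.
by case: (irr _ _ (cpre _ cA) (cpre _ cB) FAB) => H; [left|right];
  exact/image_subP.
Qed.

Record KB (X : topologicalType) := MkKB {
  KB_set :> set X;
  KB_irreducible : irreducible_set KB_set;
  KB_closed : closed KB_set;
  KB_has_sup : exists s, is_sup KB_set s
}.

HB.instance Definition _ (X : topologicalType) := gen_eqMixin (KB X).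
HB.instance Definition _ (X : topologicalType) := gen_choiceMixin (KB X).

Section KBTopology.
Context {X : topologicalType}.

Definition KB_sub (F : set X) : set (KB X) := [set A | A `<=` F].

Definition KB_open : set_system (KB X) :=
  [set U | exists2 F : set X, closed F & ~` U = KB_sub F].

Lemma KB_openT : KB_open setT.
Proof.
exists set0; first exact: closed0.
rewrite setCT; apply/seteqP; split=> // A /= A0.
by have [[x /A0]] := KB_irreducible A.
Qed.

Lemma KB_openI : setI_closed KB_open.
Proof.
move=> U V [F cF UF] [G cG VG]; exists (F `|` G); first exact: closedU.
rewrite setCI UF VG; apply/seteqP; split=> A /=.
  by case=> AF x /AF; [left|right].
by have [_ irr] := KB_irreducible A; move/(irr _ _ cF cG).
Qed.

Lemma KB_open_bigcup (I : Type) (U : I -> set (KB X)) :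
  (forall i, KB_open (U i)) -> KB_open (\bigcup_i U i).
Proof.
move=> /(_ _)/cid2-/all_sig2[F cF UF].
exists (\bigcap_i F i); first by apply: closed_bigI => i _; exact: cF.
rewrite setC_bigcup; apply/seteqP; split=> A /=.
  by move=> UA x Ax i _; have := UA i Logic.I; rewrite UF; exact.
by move=> AF i _; rewrite UF => x /AF; exact.
Qed.

HB.instance Definition _ :=
  isOpenTopological.Build (KB X) KB_openT KB_openI KB_open_bigcup.

Lemma KB_closedP (K : set (KB X)) :
  closed K <-> exists2 F : set X, closed F & K = KB_sub F.
Proof. by rewrite -openC -[K in X in _ <-> X]setCK. Qed.

(* The supremum of a member of [KB X]; it is unique when [X] is T0. *)
Definition KB_sup (F : KB X) : X := sval (cid (KB_has_sup F)).

Lemma KB_supP (F : KB X) : is_sup F (KB_sup F).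
Proof. exact: svalP (cid (KB_has_sup F)). Qed.

Definition KB_equiv : rel (KB X) := fun F G => KB_sup F == KB_sup G.

Lemma KB_equiv_refl : reflexive KB_equiv.
Proof. by move=> F; exact: eqxx. Qed.

Lemma KB_equiv_sym : symmetric KB_equiv.
Proof. by move=> F G; exact: eq_sym. Qed.

Lemma KB_equiv_trans : transitive KB_equiv.
Proof. by move=> G F H /eqP FG /eqP GH; apply/eqP; rewrite FG. Qed.

Canonical KB_equivRel :=
  EquivRel KB_equiv KB_equiv_refl KB_equiv_sym KB_equiv_trans.

End KBTopology.

Definition KB_quotient (X : topologicalType) : topologicalType :=
  quotient_topology {eq_quot (@KB_equiv X)}%qT.

Definition qkbounded_sober (X : topologicalType) :=
  kolmogorov_space X /\ kbounded_sober (KB_quotient X).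

Definition KBSob : subcat Top := @Subcat Top
  kbounded_sober
  (fun X Y (f : continuousType X Y) => True)
  (fun _ _ => Logic.I)
  (fun _ _ _ _ _ _ _ _ _ _ => Logic.I).

Lemma preserves_irreducible_sups_id (X : topologicalType) :
  preserves_irreducible_sups (@idfun X).
Proof. by move=> F _ s; rewrite image_id. Qed.

Lemma preserves_irreducible_sups_comp (X Y Z : topologicalType)
    (g : Y -> Z) (f : continuousType X Y) :
  preserves_irreducible_sups g -> preserves_irreducible_sups f ->
  preserves_irreducible_sups (g \o f).
Proof.
move=> pg pf F irrF s Fs; rewrite -image_comp; apply: pg; last exact: pf.
exact: irreducible_image (@cts_fun _ _ f) irrF.
Qed.

Definition QKBSob : subcat Top := @Subcat Top
  qkbounded_sober
  (fun X Y (f : continuousType X Y) => preserves_irreducible_sups f)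
  (fun X _ => @preserves_irreducible_sups_id X)
  (fun X Y Z g f _ _ _ => @preserves_irreducible_sups_comp X Y Z g f).

(* Main.v *)
(** The reflection of [X] is [r : X -> KB(X)/~], [r x = [cl {x}]]. It is
    surjective, because [F ~ cl {sup F}], which makes extensions along [r]
    unique. If [A] is k-bounded sober and [f : X -> A] preserves existing
    irreducible suprema, then [cl (f F) = cl {f (sup F)}] for every [F] in
    [KB(X)], so the preimage of a closed [C] under [F |-> f (sup F)] is the
    closed set [K_{f^-1 C}], and this map descends to the quotient. Taking
    [f = id] shows that [r] is a homeomorphism when [X] is k-bounded sober. *)
From HB Require Import structures.
From mathcomp Require Import all_boot all_classical.
From mathcomp Require Import topology_structure quotient_topology.
From mathcomp Require Import separation_axioms.
Require Import Defs.

Set Implicit Arguments.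
Unset Strict Implicit.
Unset Printing Implicit Defensive.

Local Open Scope classical_set_scope.

Section SpecializationOrder.
Context {X : topologicalType}.
Implicit Types (x y s : X) (F C : set X).

Lemma closure_min F C : closed C -> F `<=` C -> closure F `<=` C.
Proof. by move=> cC /closureS FC x /FC /cC. Qed.

Lemma closure1_min x C : closed C -> C x -> closure [set x] `<=` C.
Proof. by move=> cC Cx; apply: closure_min => // _ ->. Qed.

Lemma mem_closure1 x : closure [set x] x.
Proof. exact: subset_closure. Qed.

Lemma spec_le_closure1 x y : spec_le x y -> closure [set x] `<=` closure [set y].
Proof. by move=> ?; apply: closure1_min => //; exact: closed_closure. Qed.

(** A neighbourhood of [u] missing [v] is exactly a witness that [u] lies outside the closure of
    [v]; hence no such witness exists either way precisely when the two point closures coincide. *)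
Lemma kolmogorovP :
  kolmogorov_space X <-> injective (fun x => closure [set x]).
Proof.
split=> [T0 x y xy|inj x y /eqP xy].
  apply: contrapT => /eqP /T0[A].
  have main (u v : X) : closure [set u] = closure [set v] ->
      ~ (A \in nbhs u /\ v \in ~` A).
    rewrite !inE => uv [Au]; apply.
    have : closure [set v] u by rewrite -uv; exact: mem_closure1.
    by move=> /(_ _ Au)[_ [->]].
  by case; apply: main.
apply: contrapT => nA; apply: xy; apply: inj.
suff main (u v : X) : ~ (exists A : set X, A \in nbhs u /\ v \in ~` A) ->
    closure [set u] `<=` closure [set v].
  by apply/seteqP; split; apply: main => -[A HA]; apply: nA; exists A;
    [left|right].
move=> nuv; apply: spec_le_closure1 => A Au; exists v; split=> //.
by apply: contrapT => nAv; apply: nuv; exists A; rewrite !inE.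
Qed.

Lemma is_sup_unique F s t :
  kolmogorov_space X -> is_sup F s -> is_sup F t -> s = t.
Proof.
move=> /kolmogorovP inj [Fs sF] [Ft tF]; apply: inj.
by apply/seteqP; split; apply: spec_le_closure1; [exact: sF|exact: tF].
Qed.

Lemma is_sup_closure1 x : is_sup (closure [set x]) x.
Proof. by split=> // y; apply; exact: mem_closure1. Qed.

Lemma is_sup_closure F s : is_sup F s -> is_sup (closure F) s.
Proof.
move=> [Fs sF]; split=> [|y Fy].
  by apply: closure_min => //; exact: closed_closure.
by apply: sF => x Fx; apply: Fy; exact: subset_closure.
Qed.

Lemma irreducible_closure F : irreducible_set F -> irreducible_set (closure F).
Proof.
move=> [[x Fx] irr]; split; first by exists x; exact: subset_closure.
move=> A B cA cB FAB.
have /(irr _ _ cA cB) : F `<=` A `|` B.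
  by apply: subset_trans FAB; exact: subset_closure.
by case=> ?; [left|right]; exact: closure_min.
Qed.

Lemma irreducible_closure1 x : irreducible_set (closure [set x]).
Proof.
apply: irreducible_closure; split; first by exists x.
by move=> A B _ _ /(_ x erefl)[]; [left|right] => _ ->.
Qed.

(** Sobriety applies to the closure of [F], which stays irreducible and keeps the supremum [s]. Its
    generic point is also a supremum of it, so it equals [s] by T0. *)
Lemma kbounded_sober_closure F s : kbounded_sober X ->
  irreducible_set F -> is_sup F s -> closure F = closure [set s].
Proof.
move=> [T0 sober] irrF Fs.
have [x [clF _]] : exists! x, closure F = closure [set x].
  apply: sober; [exact: irreducible_closure|exact: closed_closure|].
  by exists s; exact: is_sup_closure.
rewrite clF; congr (closure [set _]); apply: (is_sup_unique T0).
  exact: is_sup_closure1.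
by rewrite -clF; exact: is_sup_closure.
Qed.

End SpecializationOrder.

Lemma preimage_closed_continuous (X Y : topologicalType) (f : X -> Y)
  (C : set Y) : continuous f -> closed C -> closed (f @^-1` C).
Proof. by move=> /continuous_closedP cf /cf. Qed.

Lemma continuous_spec_le (X Y : topologicalType) (f : X -> Y) (x y : X) :
  continuous f -> spec_le x y -> spec_le (f x) (f y).
Proof.
move=> cf; suff : closure [set y] `<=` f @^-1` closure [set f y] by exact.
apply: closure1_min; last exact: mem_closure1.
exact: preimage_closed_continuous cf (@closed_closure _ _).
Qed.

(** If [y] bounds the image of [F], the preimage of the closure of [y] is a closed set containing
    [F], hence also the generic point [s] of the closure of [F]. *)
Lemma kbounded_sober_preserves (X Y : topologicalType) (f : X -> Y) :
  kbounded_sober X -> continuous f -> preserves_irreducible_sups f.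
Proof.
move=> kX cf F irrF s Fs; split=> [_ [x Fx <-]|y fFy].
  by apply: continuous_spec_le => //; exact: Fs.1.
suff : closure F `<=` f @^-1` closure [set y].
  by apply; rewrite (kbounded_sober_closure kX irrF Fs); exact: mem_closure1.
apply: closure_min; first exact: preimage_closed_continuous cf (@closed_closure _ _).
by move=> x Fx; apply: fFy; exists x.
Qed.

Lemma kbounded_sober_homeo (X Y : topologicalType) (h : X -> Y) (k : Y -> X) :
  continuous h -> continuous k -> cancel h k -> cancel k h ->
  kbounded_sober X -> kbounded_sober Y.
Proof.
move=> ch ck hK kK kX.
have T0Y : kolmogorov_space Y.
  have /kolmogorovP inj := kX.1; apply/kolmogorovP => x y xy.
  rewrite -(kK x) -(kK y); congr h; apply: inj.
  apply/seteqP; split; apply: spec_le_closure1; apply: continuous_spec_le => //;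
    by [rewrite /spec_le -xy; exact: mem_closure1
       |rewrite /spec_le xy; exact: mem_closure1].
split=> // F irrF cF [s [Fs sF]].
(* Both descriptions are used: the image under [k] is irreducible, the preimage under [h] is
   closed. *)
have kFE : k @` F = h @^-1` F.
  by apply/seteqP; split=> [_ [y Fy <-] /=|x /= Fx];
    [rewrite kK|exists (h x); rewrite ?hK].
have kFs : is_sup (k @` F) (k s).
  split=> [_ [y Fy <-]|x kFx]; first by apply: continuous_spec_le => //; exact: Fs.
  rewrite -(hK x); apply: continuous_spec_le => //; apply: sF => y Fy.
  by rewrite -(kK y); apply: continuous_spec_le => //; apply: kFx; exists y.
have := kbounded_sober_closure kX (irreducible_image ck irrF) kFs.
rewrite -(closure_id _).1; last first.
  by rewrite kFE; exact: preimage_closed_continuous.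
rewrite kFE => FE.
have Fcl : F = closure [set s].
  apply/seteqP; split; first exact: Fs.
  apply: closure1_min => //; suff : (h @^-1` F) (k s) by rewrite /= kK.
  by rewrite FE; exact: mem_closure1.
by exists s; split=> // t; rewrite Fcl; have /kolmogorovP := T0Y; exact.
Qed.

Section Reflection.
Local Open Scope quotient_scope.
Context {X : topologicalType}.

(** Preservation of suprema concerns irreducible sets that need not be closed; closing one gives a
    point of [KB X] with the same supremum. *)
Definition KB_closure (F : set X) (irrF : irreducible_set F)
    (supF : exists s, is_sup F s) : KB X :=
  MkKB (irreducible_closure irrF) (@closed_closure X F)
    (let: ex_intro s Fs := supF in ex_intro _ s (is_sup_closure Fs)).

Definition KB_point (x : X) : KB X :=
  MkKB (irreducible_closure1 x) (@closed_closure X [set x])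
    (ex_intro _ x (is_sup_closure1 x)).

Definition KB_class (F : KB X) : KB_quotient X := \pi_(KB_quotient X) F.

Definition KB_unit (x : X) : KB_quotient X := KB_class (KB_point x).

Lemma KB_sub_closed (C : set X) : closed C -> closed (KB_sub C).
Proof. by move=> cC; apply/KB_closedP; exists C. Qed.

Lemma KB_class_continuous : continuous KB_class.
Proof. exact: pi_continuous. Qed.

Lemma KB_classP (F G : KB X) : KB_class F = KB_class G <-> KB_sup F = KB_sup G.
Proof.
rewrite /KB_class; split=> [/(@eqquotP _ _ {eq_quot (@KB_equiv X)})/eqP//|FG].
by apply/(@eqquotP _ _ {eq_quot (@KB_equiv X)})/eqP.
Qed.

Lemma KB_class_repr (q : KB_quotient X) : KB_class (repr q) = q.
Proof. exact: reprK. Qed.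

(** A closed set of classes pulls back to some [KB_sub F] in [KB X], and a point closure lies below
    the closed set [F] exactly when its point lies in [F]. *)
Lemma KB_unit_continuous : continuous KB_unit.
Proof.
apply/continuous_closedP => C cC.
have /KB_closedP[F cF FE] := preimage_closed_continuous KB_class_continuous cC.
suff -> : KB_unit @^-1` C = F by [].
rewrite /KB_unit; apply/seteqP; split=> x.
  by move=> /= Cx; have : (KB_class @^-1` C) (KB_point x) by []; rewrite FE;
    apply; exact: mem_closure1.
move=> Fx; suff : (KB_class @^-1` C) (KB_point x) by [].
by rewrite FE; exact: closure1_min.
Qed.

Hypothesis T0X : kolmogorov_space X.

Lemma KB_sup_point x : KB_sup (KB_point x) = x.
Proof. exact: is_sup_unique T0X (KB_supP (KB_point x)) (is_sup_closure1 x). Qed.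

Lemma KB_unit_sup F : KB_unit (KB_sup F) = KB_class F.
Proof. by apply/KB_classP; rewrite KB_sup_point. Qed.

Lemma KB_unit_preserves : preserves_irreducible_sups KB_unit.
Proof.
move=> F irrF s Fs; split=> [_ [x Fx <-]|y Fy].
  by apply: continuous_spec_le; [exact: KB_unit_continuous|exact: Fs.1].
have supF : exists s, is_sup F s by exists s.
(* This turns [KB_unit s] into the class of the closure of [F], so that lying below [y] becomes an
   inclusion in the closed set [G] below, which can be checked on the points of [F]. *)
have -> : s = KB_sup (KB_closure irrF supF).
  exact: is_sup_unique T0X (is_sup_closure Fs) (KB_supP (KB_closure _ _)).
rewrite KB_unit_sup.
have /KB_closedP[G cG GE] := preimage_closed_continuous KB_class_continuous
  (@closed_closure _ [set y]).
suff : (KB_class @^-1` closure [set y]) (KB_closure irrF supF) by [].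
rewrite GE; apply: closure_min => // x Fx.
have : (KB_class @^-1` closure [set y]) (KB_point x) by apply: Fy; exists x.
by rewrite GE; apply; exact: mem_closure1.
Qed.

Section Extension.
Context {A : topologicalType} (f : X -> A).

(** The choice of representative is harmless, since all members of a class share their supremum. *)
Definition KB_extend (q : KB_quotient X) : A := f (KB_sup (repr q)).

Lemma KB_extend_class F : KB_extend (KB_class F) = f (KB_sup F).
Proof. by congr f; apply/KB_classP; rewrite KB_class_repr. Qed.

Lemma KB_extend_unit x : KB_extend (KB_unit x) = f x.
Proof. by rewrite KB_extend_class KB_sup_point. Qed.

Lemma KB_extend_continuous : kbounded_sober A -> continuous f ->
  preserves_irreducible_sups f -> continuous KB_extend.
Proof.
move=> kA cf pf; apply/quotient_continuous/continuous_closedP => C cC.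
suff -> : (KB_extend \o \pi_(KB_quotient X)) @^-1` C = KB_sub (f @^-1` C).
  by apply: KB_sub_closed; exact: preimage_closed_continuous.
have clE (F : KB X) : closure (f @` F) = closure [set f (KB_sup F)].
  have irrF := KB_irreducible F; apply: kbounded_sober_closure => //.
    exact: irreducible_image.
  exact/pf/KB_supP.
(* By [clE], the closed set [C] contains [f (KB_sup F)] exactly when it contains the whole image of
   [F]. *)
apply/seteqP; split=> F /=.
  rewrite -/(KB_class F) KB_extend_class => CF x Fx /=.
  apply: (closure1_min cC CF); rewrite -clE.
  by apply: subset_closure; exists x.
rewrite -/(KB_class F) KB_extend_class => FC.
suff : closure (f @` F) `<=` C by apply; rewrite clE; exact: mem_closure1.
by apply: closure_min => // _ [x Fx <-]; exact: FC.
Qed.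

End Extension.

End Reflection.

Lemma kbounded_sober_qkbounded (X : topologicalType) :
  kbounded_sober X -> qkbounded_sober X.
Proof.
move=> kX; have T0X := kX.1; split=> //.
have cid : continuous (@idfun X) by move=> x.
(* The inverse of the unit sends a class to its common supremum. *)
apply: (kbounded_sober_homeo (h := KB_unit) (k := KB_extend idfun)) (kX).
- exact: KB_unit_continuous.
- by apply: KB_extend_continuous => //; exact: preserves_irreducible_sups_id.
- exact: KB_extend_unit.
- by move=> q; rewrite /KB_extend KB_unit_sup // KB_class_repr.
Qed.

HB.instance Definition _ (X : topologicalType) :=
  isContinuous.Build X (KB_quotient X) KB_unit KB_unit_continuous.

Theorem theorem4p7 : full_reflective_subcategory KBSob QKBSob.
Proof.
split.
- split=> [X|X Y f kX _ _]; first exact: kbounded_sober_qkbounded.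
  exact: kbounded_sober_preserves kX (@cts_fun _ _ f).
(* Fullness: every continuous map between k-bounded sober spaces is a morphism of [KBSob]. *)
- by [].
- move=> X [T0X kQ]; exists (KB_quotient X), (KB_unit : continuousType X _).
  split=> //; split; first exact: KB_unit_preserves.
  move=> A f kA pf.
  have cg := KB_extend_continuous kA (@cts_fun _ _ f) pf.
  pose g : continuousType (KB_quotient X) A :=
    HB.pack (KB_extend f) (isContinuous.Build _ _ _ cg).
  exists g; split.
    by split=> //; apply/continuousEP => x; exact: KB_extend_unit.
  (* Uniqueness: [q] is the unit at the supremum of its representative, so [hf] determines [h q]. *)
  move=> h [_ hf]; apply/continuousEP => q.
  rewrite -[q]KB_class_repr -KB_unit_sup //=.
  by rewrite KB_extend_unit // -hf.
Qed.
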